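(* Let $S$ be a substitution and let $X$ be a set of (abstract) variables containing every free variable of $\mathit{Mod}_X(S)$ (primed variables $x'$ being counted as their unprimed counterparts $x$). Then $\mathit{Prd}_X(S)\Leftrightarrow \mathit{Prd}_X(T_X(S))$.
   Context: Substitutions (B generalized substitutions) are built from: assignment $x:=E$; multiple assignment $x,y:=E,F$ (commutative); $\mathit{skip}$; guarded substitution $P\Rightarrow S$; bounded choice $S_1[]S_2$; local-variable substitution $@z.S$. Weakest preconditions: $[x:=E]P$ is substitution of $E$ for free $x$ in $P$ (simultaneous for multiple assignment); $[\mathit{skip}]P\Leftrightarrow P$; $[P_1\Rightarrow S]P_2\Leftrightarrow(P_1\Rightarrow[S]P_2)$; $[S_1[]S_2]P\Leftrightarrow[S_1]P\wedge[S_2]P$; $[@z.S]P\Leftrightarrow\forall z.[S]P$ ($z$ not free in $P$). Before-after predicate: for a set of variables $X$, $\mathit{Prd}_X(S)\equiv\neg[S]\neg\bigwedge_{x\in X}(x=x')$, where $x'$ denotes the after-value of $x$. Modification predicate: $\mathit{Mod}_X(S)\equiv \mathit{Prd}_X(S)\wedge\bigvee_{x\in X}(x\neq x')$ (primed variables left free). CF: conjunction of disjunctions of elementary predicates $E(Y)\,r\,F(Z)$ (expressions with variable sets $Y,Z$, relational operator $r$) or $\forall z.Q$/$\exists z.Q$ with $Q$ in CF; guards are put into CF before transformation. Predicate abstraction: $T_X(E(Y)\,r\,F(Z))=E(Y)\,r\,F(Z)$ if $Y,Z\subseteq X$, else $\mathit{true}$; $T_X(P_1\vee P_2)=T_X(P_1)\vee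 T_X(P_2)$; $T_X(P_1\wedge P_2)=T_X(P_1)\wedge T_X(P_2)$; $T_X(\alpha z.P)=\alpha z.T_{X\cup\{z\}}(P)$. Substitution abstraction: $T_X(x:=E)=\mathit{skip}$ if $x\notin X$, $x:=E$ if $x\in X$; $T_X(\mathit{skip})=\mathit{skip}$; $T_X(x,y:=E,F)$ is $\mathit{skip}$ if $x,y\notin X$, $x:=E$ if only $x\in X$ ($y:=F$ if only $y\in X$), $x,y:=E,F$ if both in $X$; $T_X(P\Rightarrow S)=T_X(P)\Rightarrow T_X(S)$; $T_X(S_1[]S_2)=T_X(S_1)[]T_X(S_2)$; $T_X(@z.S)=@z.T_{X\cup\{z\}}(S)$. *)

(* Defs.v *)
From mathcomp Require Import all_boot finmap.
From mathcomp Require Import boolp.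

Set Implicit Arguments.
Unset Strict Implicit.
Unset Printing Implicit Defensive.

Local Open Scope fset_scope.

(* Expressions are terms over an arbitrary signature: F is the type of
   function symbols and R the type of relational operators other than = and
   <>; both are interpreted over one arbitrary domain D of values (see [eeval]
   and [peval]). The type V of variables is a parameter: substitutions are
   written over [nat], before-after predicates over [dvar], so that a
   substitution cannot mention an after-value. *)

Inductive expr (F : Type) (V : Type) : Type :=
| EVar (x : V)
| EApp (f : F) (es : seq (expr F V)).
Arguments EVar {F V} x.

(* As in B, each relational operator comes with its complement. *)
Inductive relop (R : Type) : Type :=
| REq
| RNeq
| RRel (r : R)
| RNrel (r : R).
Arguments REq {R}.
Arguments RNeq {R}.

Inductive formula (F R V : Type) : Type :=
| PConst (b : bool)
| PElem (E1 : expr F V) (r : relop R) (E2 : expr F V)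
| PNot (P : formula F R V)
| PAnd (P Q : formula F R V)
| POr (P Q : formula F R V)
| PImp (P Q : formula F R V)
| PForall (z : V) (P : formula F R V)
| PExists (z : V) (P : formula F R V).
Arguments PConst {F R V} b.

Section Syntax.
Context {F R : Type}.

Fixpoint efv {V : choiceType} (E : expr F V) : {fset V} :=
  match E with
  | EVar x => [fset x]
  | EApp _ es => foldr (fun e A => efv e `|` A) fset0 es
  end.

Fixpoint pfv {V : choiceType} (P : formula F R V) : {fset V} :=
  match P with
  | PConst _ => fset0
  | PElem E1 _ E2 => efv E1 `|` efv E2
  | PNot P => pfv P
  | PAnd P Q | POr P Q | PImp P Q => pfv P `|` pfv Q
  | PForall z P | PExists z P => pfv P `\ z
  end.

Fixpoint esubst {V W : Type} (s : V -> expr F W) (E : expr F V) : expr F W :=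
  match E with
  | EVar x => s x
  | EApp f es => EApp f (map (esubst s) es)
  end.

Definition emap {V W : Type} (g : V -> W) : expr F V -> expr F W :=
  esubst (fun x => EVar (g x)).

(* Capture-free as soon as [g] is injective; used with [g := inl] only. *)
Fixpoint pmap_var {V W : Type} (g : V -> W) (P : formula F R V) : formula F R W :=
  match P with
  | PConst b => PConst b
  | PElem E1 r E2 => PElem (emap g E1) r (emap g E2)
  | PNot P => PNot (pmap_var g P)
  | PAnd P Q => PAnd (pmap_var g P) (pmap_var g Q)
  | POr P Q => POr (pmap_var g P) (pmap_var g Q)
  | PImp P Q => PImp (pmap_var g P) (pmap_var g Q)
  | PForall z P => PForall (g z) (pmap_var g P)
  | PExists z P => PExists (g z) (pmap_var g P)
  end.

Definition pconj {V : Type} (s : seq (formula F R V)) : formula F R V :=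
  foldr (@PAnd F R V) (PConst true) s.

Definition pdisj {V : Type} (s : seq (formula F R V)) : formula F R V :=
  foldr (@POr F R V) (PConst false) s.

End Syntax.

Section Semantics.
Context {F R D : Type} (fI : F -> seq D -> D) (rI : R -> D -> D -> Prop).

Fixpoint eeval {V : Type} (env : V -> D) (E : expr F V) : D :=
  match E with
  | EVar x => env x
  | EApp f es => fI f (map (eeval env) es)
  end.

Definition reval (r : relop R) (a b : D) : Prop :=
  match r with
  | REq => a = b
  | RNeq => a <> b
  | RRel r => rI r a b
  | RNrel r => ~ rI r a b
  end.

Fixpoint peval {V : eqType} (env : V -> D) (P : formula F R V) : Prop :=
  match P with
  | PConst b => b
  | PElem E1 r E2 => reval r (eeval env E1) (eeval env E2)
  | PNot P => ~ peval env P
  | PAnd P Q => peval env P /\ peval env Q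
  | POr P Q => peval env P \/ peval env Q
  | PImp P Q => peval env P -> peval env Q
  | PForall z P => forall d, peval [eta env with z |-> d] P
  | PExists z P => exists d, peval [eta env with z |-> d] P
  end.

End Semantics.

Section CF.
Context {F R V : Type}.

(* [in_cf true P]: P is in CF; [in_cf false P]: P is one of its disjunctions.
   The constants count as (variable-free) elementary predicates. *)
Fixpoint in_cf (top : bool) (P : formula F R V) : bool :=
  match P with
  | PConst _ | PElem _ _ _ => true
  | PNot _ | PImp _ _ => false
  | PAnd P Q => [&& top, in_cf true P & in_cf true Q]
  | POr P Q => in_cf false P && in_cf false Q
  | PForall _ P | PExists _ P => in_cf true P
  end.

Definition rnot (r : relop R) : relop R :=
  match r with
  | REq => RNeq
  | RNeq => REq
  | RRel r => RNrel r
  | RNrel r => RRel r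
  end.

Fixpoint cf_or_r (P Q : formula F R V) : formula F R V :=
  match Q with
  | PAnd Q1 Q2 => PAnd (cf_or_r P Q1) (cf_or_r P Q2)
  | _ => POr P Q
  end.

Fixpoint cf_or (P Q : formula F R V) : formula F R V :=
  match P with
  | PAnd P1 P2 => PAnd (cf_or P1 Q) (cf_or P2 Q)
  | _ => cf_or_r P Q
  end.

(* [to_cf true P] is a CF of P, [to_cf false P] a CF of the negation of P. *)
Fixpoint to_cf (b : bool) (P : formula F R V) : formula F R V :=
  match P with
  | PConst c => PConst (c == b)
  | PElem E1 r E2 => PElem E1 (if b then r else rnot r) E2
  | PNot P => to_cf (~~ b) P
  | PAnd P Q => (if b then @PAnd F R V else cf_or) (to_cf b P) (to_cf b Q)
  | POr P Q => (if b then cf_or else @PAnd F R V) (to_cf b P) (to_cf b Q)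
  | PImp P Q => (if b then cf_or else @PAnd F R V) (to_cf (~~ b) P) (to_cf b Q)
  | PForall z P => (if b then @PForall F R V else @PExists F R V) z (to_cf b P)
  | PExists z P => (if b then @PExists F R V else @PForall F R V) z (to_cf b P)
  end.

Definition cf : formula F R V -> formula F R V := to_cf true.

End CF.

Section CFTheory.
Context {F R : Type}.

Lemma in_cf_or_r (V : Type) (P Q : formula F R V) :
  in_cf false P -> in_cf true Q -> in_cf true (cf_or_r P Q).
Proof.
move=> cP; elim: Q => //=; try by move=> *; rewrite cP.
by move=> Q1 IH1 Q2 IH2 /andP[/IH1 -> /IH2 ->].
Qed.

Lemma in_cf_or (V : Type) (P Q : formula F R V) :
  in_cf true P -> in_cf true Q -> in_cf true (cf_or P Q).
Proof.
move=> + cQ; elim: P => //=; try by move=> *; apply: in_cf_or_r.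
by move=> P1 IH1 P2 IH2 /andP[/IH1 -> /IH2 ->].
Qed.

Lemma in_cf_cf (V : Type) (P : formula F R V) : in_cf true (cf P).
Proof.
suff H b : in_cf true (to_cf b P) by apply: H.
elim: P b => //=.
- by move=> P IHP Q IHQ [] /=; rewrite ?IHP ?IHQ // in_cf_or.
- by move=> P IHP Q IHQ [] /=; rewrite ?IHP ?IHQ // in_cf_or.
- by move=> P IHP Q IHQ [] /=; rewrite ?IHP ?IHQ // in_cf_or.
- by move=> z P IHP [] /=.
- by move=> z P IHP [] /=.
Qed.

Lemma cf_id (V : Type) (P : formula F R V) : in_cf true P -> cf P = P.
Proof.
suff H b : in_cf b P -> cf P = P by apply: H.
rewrite /cf; elim: P b => //=.
- by case.
- by move=> P IHP Q IHQ b /and3P[_ /IHP-> /IHQ->].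
- move=> P IHP Q IHQ b /andP[cP cQ]; rewrite (IHP _ cP) (IHQ _ cQ).
  by case: P cP {IHP} => //= *; case: Q cQ {IHQ}.
- by move=> z P IHP b /IHP->.
- by move=> z P IHP b /IHP->.
Qed.

Context {D : Type} (fI : F -> seq D -> D) (rI : R -> D -> D -> Prop).
Notation peval := (peval fI rI).

Lemma peval_cf_or (V : eqType) (env : V -> D) (P Q : formula F R V) :
  peval env (cf_or P Q) <-> peval env P \/ peval env Q.
Proof.
have HR P' : peval env (cf_or_r P' Q) <-> peval env P' \/ peval env Q.
  elim: Q => //= Q1 IH1 Q2 IH2; rewrite IH1 IH2; tauto.
elim: P; try by move=> *; apply: HR.
by move=> P1 IH1 P2 IH2 /=; rewrite IH1 IH2; tauto.
Qed.

Lemma peval_cf (V : eqType) (env : V -> D) (P : formula F R V) :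
  peval env (cf P) <-> peval env P.
Proof.
suff H b : peval env (to_cf b P) <-> if b then peval env P else ~ peval env P.
  exact: (H true).
elim: P b env => /=.
- by case=> [] [] env /=; split=> // H; case: H.
- move=> E1 r E2 [] env //.
  by case: r => [||r|r] /=; split=> // [H /(_ H)|] //; apply: contrapT.
- by move=> P IH [] env /=; rewrite IH //; split=> [H //|/contrapT].
- move=> P IHP Q IHQ [] env /=; rewrite ?peval_cf_or IHP IHQ //.
  by split=> [|/not_andP]; tauto.
- by move=> P IHP Q IHQ [] env /=; rewrite ?peval_cf_or ?IHP ?IHQ //; tauto.
- move=> P IHP Q IHQ [] env /=; rewrite ?peval_cf_or ?IHP ?IHQ //=.
    by have := pselect (peval env P); tauto.
  by have := pselect (peval env P); tauto.
- move=> z P IH [] env /=; first by split=> H d; apply/(IH true).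
  split=> [[d /(IH false) H] H'|/existsNP[d H]]; first exact: H.
  by exists d; apply/(IH false).
- move=> z P IH [] env /=.
    by split=> -[d H]; exists d; apply/(IH true).
  split=> [H [d Hd]|H d]; first by have /(IH false) := H d.
  by apply/(IH false) => Hd; apply: H; exists d.
Qed.

End CFTheory.

(* Variable names are natural numbers; [inl x] is the variable x and [inr x] its after-value x'. *)
Notation dvar := (nat + nat)%type.

Definition base (v : dvar) : nat := match v with inl x | inr x => x end.

Definition fresh (A : {fset dvar}) : dvar :=
  inl (\max_(v <- enum_fset A) base v).+1.

Inductive gsubst (F R : Type) : Type :=
| Assign (x : nat) (E : expr F nat)
| Assign2 (x y : nat) (E1 E2 : expr F nat) of x != y
| Skip
| Guard (P : formula F R nat) (S : gsubst F R)
| BChoice (S1 S2 : gsubst F R)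
| Local (z : nat) (S : gsubst F R).
Arguments Skip {F R}.
Arguments Assign {F R} x E.
Arguments Assign2 {F R x y} E1 E2 _.

Section GeneralizedSubstitutions.
Context {F R : Type}.
Implicit Types (P : formula F R dvar) (S : gsubst F R) (X : {fset nat}).

(* The bound variable is renamed only if it would capture a variable. *)
Definition binder (s : dvar -> expr F dvar) (z : dvar) P : dvar :=
  let A := \bigcup_(v <- enum_fset (pfv P `\ z)) efv (s v) in
  if z \in A then fresh A else z.

(* Simultaneous capture-avoiding substitution. *)
Fixpoint psubst (s : dvar -> expr F dvar) P : formula F R dvar :=
  match P with
  | PConst b => PConst b
  | PElem E1 r E2 => PElem (esubst s E1) r (esubst s E2)
  | PNot P => PNot (psubst s P)
  | PAnd P Q => PAnd (psubst s P) (psubst s Q)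
  | POr P Q => POr (psubst s P) (psubst s Q)
  | PImp P Q => PImp (psubst s P) (psubst s Q)
  | PForall z P => let w := binder s z P in
      PForall w (psubst [eta s with z |-> EVar w] P)
  | PExists z P => let w := binder s z P in
      PExists w (psubst [eta s with z |-> EVar w] P)
  end.

(* Free variables of a substitution, assigned ones included. *)
Fixpoint gfv S : {fset nat} :=
  match S with
  | Assign x E => x |` efv E
  | @Assign2 _ _ x y E1 E2 _ => [fset x; y] `|` (efv E1 `|` efv E2)
  | Skip => fset0
  | Guard P S1 => pfv P `|` gfv S1
  | BChoice S1 S2 => gfv S1 `|` gfv S2
  | Local z S1 => gfv S1 `\ z
  end.

(* When z is free in P, the proviso of the rule for @z.S is restored by
   renaming: with w fresh, P is P[w/z][z/w], so [@z.S]P is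
   (forall z. [S](P[w/z]))[z/w], in which the outer capture-avoiding
   substitution renames the bound z. *)
Fixpoint wp S P : formula F R dvar :=
  match S with
  | Assign x E => psubst [eta EVar with inl x |-> emap inl E] P
  | @Assign2 _ _ x y E1 E2 _ =>
      psubst [eta EVar with inl x |-> emap inl E1, inl y |-> emap inl E2] P
  | Skip => P
  | Guard G S1 => PImp (pmap_var inl G) (wp S1 P)
  | BChoice S1 S2 => PAnd (wp S1 P) (wp S2 P)
  | Local z S1 =>
      if inl z \notin pfv P then PForall (inl z) (wp S1 P)
      else
        let w := fresh (pfv P `|` [fset (inl x : dvar) | x in gfv S1]) in
        psubst [eta EVar with w |-> EVar (inl z)]
          (PForall (inl z)
             (wp S1 (psubst [eta EVar with inl z |-> EVar w] P)))
  end.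

Definition Prd X S : formula F R dvar :=
  PNot (wp S (PNot (pconj
    [seq PElem (EVar (inl x)) REq (EVar (inr x)) | x <- enum_fset X]))).

Definition Mod X S : formula F R dvar :=
  PAnd (Prd X S) (pdisj
    [seq PElem (EVar (inl x)) RNeq (EVar (inr x)) | x <- enum_fset X]).

(* Meaningful on predicates in CF only (see [in_cf_cf]): the value on [PNot]
   and [PImp], which do not occur in CF, is a dummy. *)
Fixpoint Tpred X (P : formula F R nat) : formula F R nat :=
  match P with
  | PConst b => PConst b
  | PElem E1 r E2 =>
      if (efv E1 `<=` X) && (efv E2 `<=` X) then PElem E1 r E2 else PConst true
  | PAnd P Q => PAnd (Tpred X P) (Tpred X Q)
  | POr P Q => POr (Tpred X P) (Tpred X Q)
  | PForall z P => PForall z (Tpred (z |` X) P)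
  | PExists z P => PExists z (Tpred (z |` X) P)
  | PNot _ | PImp _ _ => PConst true
  end.

Fixpoint Tsubst X S : gsubst F R :=
  match S with
  | Assign x E => if x \in X then Assign x E else Skip
  | @Assign2 _ _ x y E1 E2 ne =>
      match x \in X, y \in X with
      | true, true => Assign2 E1 E2 ne
      | true, false => Assign x E1
      | false, true => Assign y E2
      | false, false => Skip
      end
  | Skip => Skip
  | Guard P S1 => Guard (Tpred X (cf P)) (Tsubst X S1)
  | BChoice S1 S2 => BChoice (Tsubst X S1) (Tsubst X S2)
  | Local z S1 => Local z (Tsubst (z |` X) S1)
  end.

End GeneralizedSubstitutions.

(* Main.v *)
(* The predicate transformer [wpsem] is the semantic counterpart of [wp]; on
   it, the renamings that [wp] performs for local variables disappear. A
   variable read by a guard of S, or by an expression assigned to a variable of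
   X, is either bound by an enclosing @z or free in Prd_X(S), hence in X. So the
   abstraction leaves the guards unchanged and only drops assignments to
   variables outside X, on which the postcondition does not depend. *)

Require Import Defs.
From mathcomp Require Import all_boot finmap.
From mathcomp Require Import boolp.

Set Implicit Arguments.
Unset Strict Implicit.
Unset Printing Implicit Defensive.

Local Open Scope fset_scope.

Notation upd e x d := (fun_of_simpl [eta e with x |-> d]).

(** * Free variables under substitution, renaming and passage to CF *)

Section Syntax.
Context {F R : Type}.

(** Terms nest through lists, so the inner induction on [es] supplies the hypothesis for each
    argument of a function symbol. *)
Lemma expr_nested_ind (V : Type) (K : expr F V -> Prop) :
  (forall x, K (EVar x)) ->
  (forall f es, foldr (fun E => and (K E)) True es -> K (EApp f es)) ->
  forall E, K E.
Proof.
move=> KVar KApp; fix IH 1 => -[x|f es]; first exact: KVar.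
by apply: KApp; elim: es => //= E es IHes; split.
Qed.

Lemma efv_esubst (V W : choiceType) (s : V -> expr F W) E u v :
  u \in efv E -> v \in efv (s u) -> v \in efv (esubst s E).
Proof.
elim/expr_nested_ind: E => [x|f es] /=; first by rewrite inE => /eqP ->.
elim: es => //= E es IH [HE Hes]; rewrite !inE => /orP[uE|ues] vs.
  by rewrite HE.
by rewrite IH ?orbT.
Qed.

Lemma fresh_notin (A : {fset dvar}) : fresh A \notin A.
Proof.
apply/negP => /= Ain.
have := @leq_bigmax_seq _ (enum_fset A) xpredT base _ Ain isT.
by rewrite /fresh /= ltnn.
Qed.

(** Either [z] already avoids every variable that [s] brings in, or it is replaced by a fresh
    name. *)
Lemma binder_notin (s : dvar -> expr F dvar) z (P : formula F R dvar) u :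
  u \in pfv P `\ z -> binder s z P \notin efv (s u).
Proof.
move=> uP; rewrite /binder; set A := \bigcup_(v <- _) _.
have sA : efv (s u) `<=` A by apply: (bigfcup_sup (P := xpredT)).
apply: contra (fsubsetP sA _) _.
by case: ifP => [_|->] //; apply: fresh_notin.
Qed.

(** Capture avoidance is the reason: no renamed binder can hide a variable brought in by [s u]. *)
Lemma pfv_psubst (s : dvar -> expr F dvar) (P : formula F R dvar) u v :
  u \in pfv P -> v \in efv (s u) -> v \in pfv (psubst s P).
Proof.
have bind z (Q : formula F R dvar) (s' : dvar -> expr F dvar) :
    (forall s, u \in pfv Q -> v \in efv (s u) -> v \in pfv (psubst s Q)) ->
    u \in pfv Q `\ z -> v \in efv (s' u) ->
    v \in pfv (psubst (upd s' z (EVar (binder s' z Q))) Q) `\ binder s' z Q.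
  move=> IH uQ vs; have wv := binder_notin s' uQ.
  move: uQ; rewrite !inE => /andP[uz uQ]; apply/andP; split.
    by apply: contraNneq wv => <-.
  by apply: IH => //=; rewrite (negPf uz).
elim: P s => //= [E1 r E2|P IHP Q IHQ|P IHP Q IHQ|P IHP Q IHQ|z P IH|z P IH] s.
- by rewrite !inE => /orP[] uE /(efv_esubst uE) ->; rewrite ?orbT.
- by rewrite !inE => /orP[/(IHP s) H|/(IHQ s) H] /H ->; rewrite ?orbT.
- by rewrite !inE => /orP[/(IHP s) H|/(IHQ s) H] /H ->; rewrite ?orbT.
- by rewrite !inE => /orP[/(IHP s) H|/(IHQ s) H] /H ->; rewrite ?orbT.
- exact: bind.
- exact: bind.
Qed.

Lemma efv_emap (V W : choiceType) (g : V -> W) (E : expr F V) x :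
  x \in efv E -> g x \in efv (emap g E).
Proof. by move=> xE; apply: (efv_esubst xE); rewrite inE. Qed.

Lemma pfv_pmap_var (V W : choiceType) (g : V -> W) (P : formula F R V) x :
  injective g -> x \in pfv P -> g x \in pfv (pmap_var g P).
Proof.
move=> gI.
elim: P => //= [E1 r E2|P IHP Q IHQ|P IHP Q IHQ|P IHP Q IHQ|z P IH|z P IH].
- by rewrite !inE => /orP[] /(efv_emap g) ->; rewrite ?orbT.
- by rewrite !inE => /orP[/IHP|/IHQ] ->; rewrite ?orbT.
- by rewrite !inE => /orP[/IHP|/IHQ] ->; rewrite ?orbT.
- by rewrite !inE => /orP[/IHP|/IHQ] ->; rewrite ?orbT.
- by rewrite !inE (inj_eq gI) => /andP[-> /IH].
- by rewrite !inE (inj_eq gI) => /andP[-> /IH].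
Qed.

Lemma pfv_cf_or (V : choiceType) (P Q : formula F R V) :
  pfv (cf_or P Q) `<=` pfv P `|` pfv Q.
Proof.
have HR P' : pfv (cf_or_r P' Q) `<=` pfv P' `|` pfv Q.
  elim: Q => //= Q1 IH1 Q2 IH2; rewrite fsubUset.
  by rewrite (fsubset_trans IH1) ?(fsubset_trans IH2) //
    fsetUS // ?fsubsetUl ?fsubsetUr.
elim: P; try by move=> *; apply: HR.
move=> P1 IH1 P2 IH2 /=; rewrite fsubUset.
by rewrite (fsubset_trans IH1) ?(fsubset_trans IH2) //
    fsetSU // ?fsubsetUl ?fsubsetUr.
Qed.

Lemma pfv_cf (V : choiceType) (P : formula F R V) : pfv (cf P) `<=` pfv P.
Proof.
suff H b : pfv (to_cf b P) `<=` pfv P by apply: H.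
have cup (A B C : {fset V}) (A' B' : {fset V}) : C `<=` A `|` B ->
    A `<=` A' -> B `<=` B' -> C `<=` A' `|` B'.
  by move=> CAB AA BB; apply: fsubset_trans CAB _; apply: fsetUSS.
elim: P b => //= [P IHP Q IHQ|P IHP Q IHQ|P IHP Q IHQ|z P IH|z P IH] b.
- by apply: cup (IHP b) (IHQ b); case: b => //=; apply: pfv_cf_or.
- by apply: cup (IHP b) (IHQ b); case: b => //=; apply: pfv_cf_or.
- by apply: cup (IHP (~~ b)) (IHQ b); case: b => //=; apply: pfv_cf_or.
- by case: b => /=; apply: fsetSD.
- by case: b => /=; apply: fsetSD.
Qed.

(** An elementary predicate reads only free variables of [P] and enclosing bound variables, which
    abstraction adds to [X]; CF rules out the dummy cases of [Tpred]. *)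
Lemma Tpred_id b (X : {fset nat}) (P : formula F R nat) :
  in_cf b P -> pfv P `<=` X -> Tpred X P = P.
Proof.
have under z (A Z : {fset nat}) : A `\ z `<=` Z -> A `<=` z |` Z.
  by rewrite fsubDset.
elim: P b X => //= [E1 r E2|P IHP Q IHQ|P IHP Q IHQ|z P IH|z P IH] b X.
- by rewrite fsubUset => _ ->.
- move=> /and3P[_ cP cQ]; rewrite fsubUset.
  by move=> /andP[/(IHP _ _ cP)-> /(IHQ _ _ cQ)->].
- move=> /andP[cP cQ]; rewrite fsubUset.
  by move=> /andP[/(IHP _ _ cP)-> /(IHQ _ _ cQ)->].
- by move=> cP /under /(IH _ _ cP) ->.
- by move=> cP /under /(IH _ _ cP) ->.
Qed.

End Syntax.

(** * Coincidence and substitution lemmas *)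

Section Semantics.
Context {F R D : Type} (fI : F -> seq D -> D) (rI : R -> D -> D -> Prop).
Notation peval := (peval fI rI).
Notation eeval := (eeval fI).

Lemma eq_eeval (V : choiceType) (E : expr F V) (e1 e2 : V -> D) :
  {in efv E, e1 =1 e2} -> eeval e1 E = eeval e2 E.
Proof.
elim/(@expr_nested_ind F): E => [x|f es IH] /= He.
  by apply: He; rewrite inE.
congr (fI f _); elim: es IH He => //= E es IHes [HE Hes] He.
by rewrite HE ?IHes // => x xin; apply: He; rewrite inE xin ?orbT.
Qed.

Lemma eq_peval (V : choiceType) (P : formula F R V) (e1 e2 : V -> D) :
  {in pfv P, e1 =1 e2} -> peval e1 P <-> peval e2 P.
Proof.
have under z A (f1 f2 : V -> D) d : {in A `\ z, f1 =1 f2} ->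
    {in A, upd f1 z d =1 upd f2 z d}.
  by move=> He x xA /=; case: eqP => // /eqP xz; apply: He; rewrite !inE xz.
have cup A B (f1 f2 : V -> D) : {in A `|` B, f1 =1 f2} ->
    {in A, f1 =1 f2} /\ {in B, f1 =1 f2}.
  by move=> He; split=> x xin; apply: He; rewrite inE xin ?orbT.
elim: P e1 e2 => //= [E1 r E2|P IH|P IHP Q IHQ|P IHP Q IHQ|P IHP Q IHQ
  |z P IH|z P IH] e1 e2.
- by move=> /cup[/eq_eeval-> /eq_eeval->].
- by move=> /IH ->.
- by move=> /cup[/IHP-> /IHQ->].
- by move=> /cup[/IHP-> /IHQ->].
- by move=> /cup[/IHP-> /IHQ->].
- by move=> He; split=> H d; move: (H d); rewrite (IH _ _ (under _ _ _ _ d He)).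
- move=> He.
  by split=> -[d H]; exists d; move: H; rewrite (IH _ _ (under _ _ _ _ d He)).
Qed.

Lemma eeval_esubst (V W : Type) (s : V -> expr F W) E (e : W -> D) :
  eeval e (esubst s E) = eeval (fun v => eeval e (s v)) E.
Proof.
elim/(@expr_nested_ind F): E => //= f es IH; congr (fI f _).
by elim: es IH => //= E es IHes [-> /IHes ->].
Qed.

Lemma peval_psubst s (P : formula F R dvar) (e : dvar -> D) :
  peval e (psubst s P) <-> peval (fun v => eeval e (s v)) P.
Proof.
(* The binder [w] does not occur in [s' v] for any other free [v] of [Q], so giving [w] the value
   [d] affects only what replaces [z]. *)
have under z (Q : formula F R dvar) (s' : dvar -> expr F dvar) e' d
    (w := binder s' z Q) :
    {in pfv Q, (fun v => eeval (upd e' w d) (upd s' z (EVar w) v)) =1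
               upd (fun v => eeval e' (s' v)) z d}.
  move=> v vQ /=; case: eqP => [_|/eqP vz] /=; first by rewrite eqxx.
  have vQz : v \in pfv Q `\ z by rewrite !inE vz.
  apply: eq_eeval => x xs /=; case: eqP => // xw.
  by have := binder_notin s' vQz; rewrite -/w -xw xs.
elim: P s e => //= [E1 r E2|P IH|P IHP Q IHQ|P IHP Q IHQ|P IHP Q IHQ
  |z P IH|z P IH] s e.
- by rewrite !eeval_esubst.
- by rewrite IH.
- by rewrite IHP IHQ.
- by rewrite IHP IHQ.
- by rewrite IHP IHQ.
- by split=> H d; move: (H d); rewrite IH (eq_peval (under _ _ _ _ d)).
- by split=> -[d H]; exists d; move: H; rewrite IH (eq_peval (under _ _ _ _ d)).
Qed.

Lemma peval_pmap_var (V W : eqType) (g : V -> W) (P : formula F R V)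
    (e : W -> D) :
  injective g -> peval e (pmap_var g P) <-> peval (e \o g) P.
Proof.
move=> gI.
have under z (e' : W -> D) d : upd e' (g z) d \o g = upd (e' \o g) z d.
  by apply: funext => x /=; rewrite (inj_eq gI).
elim: P e => //= [E1 r E2|P IH|P IHP Q IHQ|P IHP Q IHQ|P IHP Q IHQ
  |z P IH|z P IH] e.
- by rewrite /emap !eeval_esubst.
- by rewrite IH.
- by rewrite IHP IHQ.
- by rewrite IHP IHQ.
- by rewrite IHP IHQ.
- by split=> H d; move: (H d); rewrite IH under.
- by split=> -[d H]; exists d; move: H; rewrite IH under.
Qed.

(** * Semantic weakest preconditions and read scopes *)

Implicit Types (S : gsubst F R) (e : nat -> D) (Q : (nat -> D) -> Prop).

Lemma updC e x y a b : x != y -> upd (upd e x a) y b = upd (upd e y b) x a.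
Proof.
move=> xy; apply: funext => v /=; case: (eqVneq v y) => // ->.
by rewrite eq_sym (negPf xy).
Qed.

Lemma upd_upd e x a b : upd (upd e x a) x b = upd e x b.
Proof. by apply: funext => v /=; case: eqP. Qed.

(** For a local [z], the outer value [e z] is restored before [Q] is tested; this gives static
    scoping without fresh names. *)
Fixpoint wpsem S Q e : Prop :=
  match S with
  | Assign x E => Q (upd e x (eeval e E))
  | @Assign2 _ _ x y E1 E2 _ =>
      Q [eta e with x |-> eeval e E1, y |-> eeval e E2]
  | Skip => Q e
  | Guard P S1 => peval e P -> wpsem S1 Q e
  | BChoice S1 S2 => wpsem S1 Q e /\ wpsem S2 Q e
  | Local z S1 => forall d, wpsem S1 (fun e1 => Q (upd e1 z (e z))) (upd e z d)
  end.

Lemma eq_wpsem S Q1 Q2 e : (forall e1, Q1 e1 <-> Q2 e1) ->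
  wpsem S Q1 e <-> wpsem S Q2 e.
Proof.
by move=> Q12; have -> : Q1 = Q2 by apply: funext => e1; apply/propext.
Qed.

Lemma eeval_upd (E : expr F nat) e w a : w \notin efv E ->
  eeval (upd e w a) E = eeval e E.
Proof.
move=> wE; apply: eq_eeval => x xE /=.
by case: eqP => // xw; rewrite -xw xE in wE.
Qed.

(** Later used to move the value of a fresh variable past [S]. *)
Lemma wpsem_upd S Q e w a : w \notin gfv S ->
  wpsem S Q (upd e w a) <-> wpsem S (fun e1 => Q (upd e1 w a)) e.
Proof.
elim: S Q e => //= [x E|x y E1 E2 xy|P S IH|S1 IH1 S2 IH2|z S IH] Q e.
- by rewrite !inE negb_or => /andP[wx wE]; rewrite eeval_upd // updC.
- rewrite !inE !negb_or -!andbA => /and4P[wx wy w1 w2]; rewrite !eeval_upd //.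
  set e1 := (X in Q X); set e2 := (X in _ <-> Q X).
  suff -> : e1 = e2 by [].
  apply: funext => v; rewrite /e1 /e2 /=.
  by case: (eqVneq v w) => // ->; rewrite (negPf wx) (negPf wy).
- rewrite inE negb_or => /andP[wP wS]; rewrite IH //.
  suff -> : peval (upd e w a) P <-> peval e P by [].
  by apply: eq_peval => x xP /=; case: eqP => // xw; rewrite -xw xP in wP.
- by rewrite inE negb_or => /andP[w1 w2]; rewrite IH1 // IH2.
- rewrite !inE negb_and negbK => wzS.
  (* If [w] is the local variable itself, [d] hides [a] inside the body, and on exit [a] returns: by
     restoration on one side, by the final update on the other. *)
  case: (eqVneq w z) wzS => [<- _|wz /= wS].
    split=> H d; move: (H d); rewrite /= ?eqxx upd_upd;
      apply: iffLR; apply: eq_wpsem => e1; by rewrite upd_upd.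
  by split=> H d; move: (H d); rewrite updC // IH //=;
    apply: iffLR; apply: eq_wpsem => e1; rewrite (updC _ _ _ wz).
Qed.

(** Execution changes unprimed variables only; after-values are parameters fixed by [env]. *)
Definition merge (env : dvar -> D) e : dvar -> D :=
  fun v => if v is inl x then e x else env v.

Lemma peval_wp S (P : formula F R dvar) env :
  peval env (wp S P) <-> wpsem S (fun e => peval (merge env e) P) (env \o inl).
Proof.
have inlI : injective (@inl nat nat) by move=> ? ? [].
elim: S P env => /= [x E|x y E1 E2 xy||G S IH|S1 IH1 S2 IH2|z S IH] P env.
- rewrite peval_psubst; apply: eq_peval => -[v|v] _ //=.
  rewrite (inj_eq inlI); case: eqP => // _.
  by rewrite /emap eeval_esubst.
- rewrite peval_psubst; apply: eq_peval => -[v|v] _ //=.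
  by rewrite !(inj_eq inlI); case: eqP => _ //=; [|case: eqP => _ //=];
    rewrite /emap eeval_esubst.
- by apply: eq_peval => -[].
- by rewrite peval_pmap_var // IH.
- by rewrite IH1 IH2.
have upd_inl (e : dvar -> D) d : upd e (inl z) d \o inl = upd (e \o inl) z d.
  by apply: funext => x /=; rewrite (inj_eq inlI).
(* If [z] is not free in [P], restoring it is invisible to [P]. *)
case: ifPn => [zP|/negPn zP].
  split=> /= H d; move: (H d); rewrite IH upd_inl;
    apply: iffLR; apply: eq_wpsem => e1; apply: eq_peval => -[v|v] vP //=;
    by case: eqP => // vz; rewrite -vz vP in zP.
have := fresh_notin (pfv P `|` [fset (inl x : dvar) | x in gfv S]).
set w := fresh _; rewrite inE negb_or => /andP[wP wS].
(* [fresh] always returns an unprimed variable; it is called [k] from here on. *)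
have wE : w = inl (base w) by [].
move: wE wP wS; move: (base w) => k -> {w} wP wS.
have {}wS : k \notin gfv S by apply: contra wS => kS; apply/imfsetP; exists k.
have kz : k != z by apply: contraNneq wP => ->.
apply: iff_trans
  (peval_psubst [eta EVar with inl k |-> EVar (inl z)] (PForall (inl z) _)
     env) _.
rewrite /=; set env0 := (fun v => eeval env _).
(* The outer substitution makes [k] hold the outer value of [z]. As [S] does not mention [k], this
   value survives [S], and the renamed postcondition reads it in place of [z]: exactly the
   restoration in [wpsem]. *)
have env0E d : upd env0 (inl z) d \o inl =
    upd (upd (env \o inl) z d) k (env (inl z)).
  rewrite -updC //; apply: funext => v; rewrite /env0 /= !(inj_eq inlI).
  by case: (eqVneq v z) => // _; case: (eqVneq v k).
split=> H d; move: (H d); rewrite IH env0E (wpsem_upd _ _ _ wS);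
  apply: iffLR; apply: eq_wpsem => e1;
  rewrite peval_psubst; apply: eq_peval => -[v|v] vP //=;
  rewrite !(inj_eq inlI); case: (eqVneq v z) => [_|vz] /=; rewrite ?eqxx //;
  by case: (eqVneq v k) => // vk; rewrite -vk vP in wP.
Qed.

(* [Y] is the set of variables whose final value matters, [X] the set of
   variables that may be read. *)
Fixpoint scoped (X Y : {fset nat}) S : bool :=
  match S with
  | Assign x E => (x \in Y) ==> (efv E `<=` X)
  | @Assign2 _ _ x y E1 E2 _ =>
      ((x \in Y) ==> (efv E1 `<=` X)) && ((y \in Y) ==> (efv E2 `<=` X))
  | Skip => true
  | Guard P S1 => (pfv P `<=` X) && scoped X Y S1
  | BChoice S1 S2 => scoped X Y S1 && scoped X Y S2
  | Local z S1 => scoped (z |` X) (Y `\ z) S1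
  end.

(** Serves to remove the fresh renaming variable from the read set. If [S] rebinds [w] locally, that
    binder adds it to the read set anyway. *)
Lemma scoped_strengthen S X Y w :
  w \notin gfv S -> scoped (w |` X) Y S -> scoped X Y S.
Proof.
have sub (A Z : {fset nat}) : w \notin A -> A `<=` w |` Z -> A `<=` Z.
  move=> wA /fsubsetP AZ; apply/fsubsetP => x xA.
  by have := AZ x xA; rewrite !inE => /predU1P[xw|//]; rewrite -xw xA in wA.
elim: S X Y => //= [x E|x y E1 E2 xy|P S IH|S1 IH1 S2 IH2|z S IH] X Y.
- rewrite !inE negb_or => /andP[_ wE] /implyP H.
  by apply/implyP => /H; apply: sub.
- rewrite !inE !negb_or -!andbA => /and4P[_ _ w1 w2].
  move=> /andP[/implyP H1 /implyP H2].
  by apply/andP; split; apply/implyP; [move/H1|move/H2]; apply: sub.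
- by rewrite inE negb_or => /andP[wP wS] /andP[/(sub _ _ wP)-> /(IH _ _ wS)].
- by rewrite inE negb_or => /andP[w1 w2] /andP[/(IH1 _ _ w1)-> /(IH2 _ _ w2)].
- rewrite !inE negb_and negbK fsetUCA.
  case: (eqVneq w z) => [->|_ wS] /=; first by rewrite fsetUA fsetUid.
  exact: IH.
Qed.

(** Guards appear in [wp S P], and an expression assigned to a variable of [Y] is substituted for a
    free occurrence; what they read is free in [wp S P] unless bound by a local. *)
Lemma scoped_wp S (P : formula F R dvar) X Y :
  (forall x, x \in Y -> inl x \in pfv P) ->
  (forall x, inl x \in pfv (wp S P) -> x \in X) -> scoped X Y S.
Proof.
have inlI : injective (@inl nat nat) by move=> ? ? [].
elim: S P X Y => //= [x E|x y E1 E2 xy|G S IH|S1 IH1 S2 IH2|z S IH] P X Y YP HX.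
- apply/implyP => /YP xP; apply/fsubsetP => v vE; apply/HX/(pfv_psubst xP).
  by rewrite /= eqxx efv_emap.
- apply/andP; split; apply/implyP => /YP xP; apply/fsubsetP => v vE;
    apply/HX/(pfv_psubst xP); rewrite /= ?eqxx ?efv_emap //.
  by rewrite (inj_eq inlI) (eq_sym y) (negPf xy) ?efv_emap.
- apply/andP; split.
    by apply/fsubsetP => v vG; apply: HX; rewrite inE pfv_pmap_var.
  by apply: (IH P) => // x xS; apply: HX; rewrite inE xS orbT.
- apply/andP; split; [apply: (IH1 P)|apply: (IH2 P)] => // x xS; apply: HX;
    by rewrite inE xS ?orbT.
move: HX; case: ifPn => [zP|/negPn zP] HX.
  apply: (IH P) => [x|x xS]; first by rewrite !inE => /andP[_ /YP].
  rewrite !inE; case: (eqVneq x z) => //= xz.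
  by apply: HX; rewrite /= !inE (inj_eq inlI) xz.
have := fresh_notin (pfv P `|` [fset (inl x : dvar) | x in gfv S]).
move: HX; set w := fresh _ => HX; rewrite inE negb_or => /andP[wP wS].
have wE : w = inl (base w) by [].
move: wE wP wS HX; move: (base w) => k -> {w} wP wS HX.
have {}wS : k \notin gfv S by apply: contra wS => kS; apply/imfsetP; exists k.
(* [k] may be free in the inner [wp], so the induction hypothesis is applied with [k] added to the
   read set. *)
apply: (scoped_strengthen wS).
apply: (IH (psubst [eta EVar with inl z |-> EVar (inl k)] P)) => [x|x xS].
  rewrite !inE => /andP[xz /YP xP]; apply: (pfv_psubst xP).
  by rewrite /= (inj_eq inlI) (negPf xz) inE.
rewrite !inE; case: (eqVneq x k) => //= xk; case: (eqVneq x z) => //= xz.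
apply: HX; apply: (@pfv_psubst _ _
  [eta EVar with inl k |-> EVar (inl z)] (PForall (inl z) _) (inl x)).
  by rewrite /= !inE (inj_eq inlI) xz.
by rewrite /= (inj_eq inlI) (negPf xk) inE.
Qed.

(** A dropped assignment has its target outside [X], hence outside [Y], and [Q] cannot see it;
    guards read only [X], so [Tpred] fixes their CF. *)
Lemma wpsem_Tsubst S X Y Q e : Y `<=` X -> scoped X Y S ->
  (forall e1 e2, {in Y, e1 =1 e2} -> Q e1 <-> Q e2) ->
  wpsem S Q e <-> wpsem (Tsubst X S) Q e.
Proof.
have neY (A Z : {fset nat}) x v : A `<=` Z -> x \notin Z -> v \in A -> v != x.
  by move=> /fsubsetP AZ xZ vA; apply: contraNneq xZ => <-; apply: AZ.
elim: S X Y Q e => //= [x E|x y E1 E2 xy|G S IH|S1 IH1 S2 IH2|z S IH]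
  X Y Q e YX.
- move=> _ HQ; case: ifPn => //= xX; apply: HQ => v vY /=.
  by rewrite (negPf (neY _ _ _ _ YX xX vY)).
- move=> _ HQ; case: ifPn => xX; case: ifPn => yX //=; apply: HQ => v vY /=;
  by rewrite ?(negPf (neY _ _ _ _ YX xX vY)) ?(negPf (neY _ _ _ _ YX yX vY)).
- move=> /andP[GX cS] HQ; rewrite (IH X Y) //.
  by rewrite (Tpred_id (in_cf_cf G)) ?peval_cf // (fsubset_trans (pfv_cf G)).
- by move=> /andP[c1 c2] HQ; rewrite (IH1 X Y) // (IH2 X Y).
move=> cS HQ.
(* Restoring [z] on exit makes the inner postcondition independent of its final value: [z] enters
   [X] but leaves [Y]. *)
have HQ' e1 e2 : {in Y `\ z, e1 =1 e2} ->
    Q (upd e1 z (e z)) <-> Q (upd e2 z (e z)).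
  move=> He; apply: HQ => v vY /=; case: (eqVneq v z) => // vz.
  by apply: He; rewrite !inE vz.
have sub : Y `\ z `<=` z |` X.
  by rewrite (fsubset_trans (fsubsetDl _ _)) // (fsubset_trans YX) ?fsubsetUr.
by split=> H d; move: (H d); rewrite (IH _ _ _ _ sub cS HQ').
Qed.

End Semantics.

(** * Invariance of the before-after predicate *)

Theorem theorem3 (F R D : Type)
    (fI : F -> seq D -> D) (rI : R -> D -> D -> Prop)
    (S : gsubst F R) (X : {fset nat})
    (hX : [fset base v | v in pfv (Mod X S)] `<=` X)
    (env : dvar -> D) :
  peval fI rI env (Prd X S) <-> peval fI rI env (Prd X (Tsubst X S)).
Proof.
rewrite /Prd /= !peval_wp.
set P := PNot (pconj _) in hX *.
have XP v : v \in pfv P -> base v \in X.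
  have : {subset enum_fset X <= X} by [].
  rewrite /P /=; elim: (enum_fset X) => //= x s IH sX.
  rewrite !inE -!orbA => /or3P[/eqP->|/eqP->|];
    try by apply: sX; rewrite mem_head.
  by apply: IH => y ys; apply: sX; rewrite inE ys orbT.
have PX x : x \in X -> inl x \in pfv P.
  rewrite /P /= -[x \in X]/(x \in enum_fset X).
  elim: (enum_fset X) => //= y s IH; rewrite !inE => /predU1P[->|/IH ->].
    by rewrite eqxx.
  by rewrite orbT.
(* Free variables of [wp S P] are free in the first conjunct of [Mod X S], so [hX] puts them in [X];
   [P] mentions every [x] of [X], whence [Y] is [X]. *)
have scS : scoped X X S.
  apply: (scoped_wp PX) => x xS; apply: (fsubsetP hX); apply/imfsetP.
  by exists (inl x) => //; rewrite /= inE xS.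
rewrite (wpsem_Tsubst _ _ _ (fsubset_refl X) scS) // => e1 e2 He.
by apply: eq_peval => -[v|v] vP //=; apply/He/(XP _ vP).
Qed.
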